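(* Let $y_F$ denote the one-dimensional (straight) configuration of atoms with nearest neighbor interatomic spacing $F\varepsilon$. If $\phi'(2F)\ge0$ and $\phi''(2F)\le0$, then $$\begin{aligned}\delta^2\mathcal E^{\mathrm{QNL}}(y_F)[u,u]\ge{}&\min\left\{\phi''(F)+4\phi''(2F),\frac{\phi'(F)}{F}\right\}\|u'\|^2_{\ell^2_\varepsilon(\mathfrak A)}\\&+\min\left\{\phi''(F)+4\phi''(2F),\frac{\phi'(F)+2\phi'(2F)}{F}\right\}\|u'\|^2_{\ell^2_\varepsilon(\mathfrak C)}\\&+\min\left\{\phi''(F)+4\phi''(2F),\frac{\phi'(F)+\phi'(2F)}{F}\right\}\|u'\|^2_{\ell^2_\varepsilon(\mathfrak I)}\\\ge{}&\min\left\{\phi''(F)+4\phi''(2F),\frac{\phi'(F)}{F}\right\}\|u'\|^2_{\ell^2_\varepsilon}\end{aligned}$$ for all $u\in\mathcal U$. In addition, as $\varepsilon\to0$, $$\inf_{u\in\mathcal U\setminus\{0\}}\frac{\delta^2\mathcal E^{\mathrm{QNL}}(y_F)[u,u]}{\|u'\|^2_{\ell^2_\varepsilon}}=\min\left\{\phi''(F)+4\phi''(2F),\ \frac{\phi'(F)}{F}+\mathcal O(\varepsilon)\right\}.$$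
   Context: Let $N\in\mathbb N$, $\varepsilon=1/N$, $F>0$, and let $K$ be an integer with $1<K<N$. $\mathcal U$ is the set of $N$-periodic sequences $u=\{u_\ell\}_{\ell\in\mathbb Z}$ in $\mathbb R^2$ with $\sum_{\ell=1}^N u_\ell=0$. Backward difference: $y'_\ell=(y_\ell-y_{\ell-1})/\varepsilon$. $\|\cdot\|$ is the Euclidean norm; $\|v\|_{\ell^2_\varepsilon}=(\varepsilon\sum_{\ell=1}^N\|v_\ell\|^2)^{1/2}$. The nonlocal (atomistic) region is $\mathfrak A=\{1,\dots,K\}$ and the local (continuum) region is $\mathfrak C=\{K+1,\dots,N\}$, extended by periodicity; $\mathfrak I$ refers to the interfacial bonds. Seminorms: $\|u'\|_{\ell^2_\varepsilon(\mathfrak A)}=(\varepsilon\sum_{\ell=2}^K\|u'_\ell\|^2)^{1/2}$, $\|u'\|_{\ell^2_\varepsilon(\mathfrak C)}=(\varepsilon\sum_{\ell=K+2}^N\|u'_\ell\|^2)^{1/2}$, $\|u'\|_{\ell^2_\varepsilon(\mathfrak I)}=(\varepsilon\|u'_1\|^2+\varepsilon\|u'_{K+1}\|^2)^{1/2}$. $\phi:(0,\infty)\to\mathbb R$ is the pair potential (with the derivatives appearing here). For sequences $y=\{y_\ell\}_{\ell\in\mathbb Z}$ in $\mathbb R^2$ with $y_{\ell+N}=y_\ell+(y_N-y_0)$ for all $\ell$, the quasi-nonlocal energy is $$\mathcal E^{\mathrm{QNL}}(y)=\varepsilon\sum_{\ell=1}^N\phi(\|y'_\ell\|)+\varepsilon\sum_{\ell=1}^K\phi(\|y'_{\ell+1}+y'_\ell\|)+\varepsilon\sum_{\ell=K+1}^N\tfrac12\left(\phi(2\|y'_\ell\|)+\phi(2\|y'_{\ell+1}\|)\right).$$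 The second variation is $\delta^2\mathcal E(y)[u,v]=\frac{\partial^2}{\partial s\partial t}\mathcal E(y+su+tv)|_{s=t=0}$. The straight configuration is $(y_F)_\ell=(F\varepsilon\ell,0)$ (up to translation along the line).
   Formalization: In the limit ε→0, K=K_N must satisfy K_N ≥ αN for some α>0 and K_N+1<N for large N: for fixed K with φ'(2F)>0 the remainder is not O(ε), and for K=N−1 with φ''(2F)<0 the value φ''(F)+4φ''(2F) is not attained. *)

(* Defs.v *)
From HB Require Import structures.
From mathcomp Require Import all_boot all_order all_algebra.
From mathcomp Require Import all_classical all_reals all_analysis.

Set Implicit Arguments.
Unset Strict Implicit.
Unset Printing Implicit Defensive.

Import Order.TTheory GRing.Theory Num.Theory.
Import numFieldNormedType.Exports.

Local Open Scope ring_scope.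
Local Open Scope classical_set_scope.

Definition eps {R : realType} (N : nat) : R := N%:R^-1.

(* The norm `|v| that MathComp puts on row vectors is the sup norm. *)
Definition enorm {R : realType} (v : 'rV[R]_2) : R :=
  Num.sqrt (\sum_(j < 2) v 0 j ^+ 2).

Definition bdiff {R : realType} (N : nat) (y : int -> 'rV[R]_2) :
    int -> 'rV[R]_2 :=
  fun l => (eps N)^-1 *: (y l - y (l - 1)).

Definition displacements (R : realType) (N : nat) : set (int -> 'rV[R]_2) :=
  [set u | (forall l : int, u (l + N%:Z) = u l) /\
           \sum_(1 <= l < N.+1) u l = 0].

Definition l2norm {R : realType} (N : nat) (v : int -> 'rV[R]_2) : R :=
  Num.sqrt (eps N * \sum_(1 <= l < N.+1) enorm (v l) ^+ 2).

(* The bonds are split as 1 | 2 .. K | K+1 | K+2 .. N: the bonds 1 and K+1 join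
   an atom of {1 .. K} to an atom of {K+1 .. N} (modulo N). *)
Definition l2norm_A {R : realType} (N K : nat) (v : int -> 'rV[R]_2) : R :=
  Num.sqrt (eps N * \sum_(2 <= l < K.+1) enorm (v l) ^+ 2).

Definition l2norm_C {R : realType} (N K : nat) (v : int -> 'rV[R]_2) : R :=
  Num.sqrt (eps N * \sum_(K.+2 <= l < N.+1) enorm (v l) ^+ 2).

Definition l2norm_I {R : realType} (N K : nat) (v : int -> 'rV[R]_2) : R :=
  Num.sqrt (eps N * enorm (v 1) ^+ 2 + eps N * enorm (v K.+1) ^+ 2).

(* The pair potential lives on (0, +oo); only its values there are used at
   configurations without coinciding nearest or next-nearest neighbors. *)
Definition energy_qnl {R : realType} (phi : R -> R) (N K : nat)
    (y : int -> 'rV[R]_2) : R :=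
  let y' := bdiff N y in
  eps N * \sum_(1 <= l < N.+1) phi (enorm (y' l)) +
  eps N * \sum_(1 <= l < K.+1) phi (enorm (y' l.+1 + y' l)) +
  eps N * \sum_(K.+1 <= l < N.+1)
    2^-1 * (phi (2 * enorm (y' l)) + phi (2 * enorm (y' l.+1))).

Definition second_variation {R : realType} (E : (int -> 'rV[R]_2) -> R)
    (y u v : int -> 'rV[R]_2) : R :=
  derive1 (fun s : R =>
    derive1 (fun t : R => E (fun l => y l + s *: u l + t *: v l)) 0) 0.

Definition straight {R : realType} (F : R) (N : nat) : int -> 'rV[R]_2 :=
  fun l => \row_(j < 2) (if j == 0 then F * eps N * l%:~R else 0).

(* Main.v *)
(* On the straight chain the second variation decouples into a longitudinal and
   a transversal quadratic form in the strains [a] and [b] (the two components of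
   [u']). Completing squares in the next-nearest neighbor terms gives
     delta^2 E = eps { A sum a^2 - phi''(2F) sum_{1..K} (a_{l+1} - a_l)^2
       + B sum b^2 + be (2 sum_{K+2..N} b^2 + b_1^2 + b_{K+1}^2)
       + be/2 sum_{1..K} (b_{l+1} + b_l)^2 }
   with A = phi''(F) + 4 phi''(2F), B = phi'(F)/F and be = phi'(2F)/F, from which
   the lower bounds can be read off. The infimum lies between min {A, B} and A;
   a strain [a] constant on the nonlocal region attains A, and an alternating
   strain [b] supported there has quotient B + O(1/K). *)

Require Import Defs.
From HB Require Import structures.
From mathcomp Require Import all_boot all_order all_algebra.
From mathcomp Require Import all_classical all_reals all_analysis.
From mathcomp Require Import ring lra zify.

Set Implicit Arguments.
Unset Strict Implicit.
Unset Printing Implicit Defensive.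

Import Order.TTheory GRing.Theory Num.Theory.
Import numFieldNormedType.Exports.

Local Open Scope ring_scope.
Local Open Scope classical_set_scope.

(** * Second derivatives along a line of configurations *)

(** The first derivative is only asked for near 0: [phi] is differentiable at positive lengths only,
    so the energy along a displacement is controlled only for small parameters. *)
Definition has_deriv2 (R : realType) (h : R -> R) (c : R) : Prop :=
  exists2 g : R -> R, (\forall t \near (0 : R), is_derive t (1 : R) h (g t)) &
                      is_derive (0 : R) (1 : R) g c.

Lemma has_deriv2D (R : realType) (h k : R -> R) (c d : R) :
  has_deriv2 h c -> has_deriv2 k d -> has_deriv2 (fun t => h t + k t) (c + d).
Proof.
move=> [g hg g0] [l kl l0]; exists (g + l); last exact: is_deriveD.
by near=> t; apply: (@is_deriveD _ _ _ h k); near: t.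
Unshelve. all: by end_near. Qed.

Lemma has_deriv2Z (R : realType) (a : R) (h : R -> R) (c : R) :
  has_deriv2 h c -> has_deriv2 (fun t => a * h t) (a * c).
Proof.
move=> [g hg g0]; exists (a \*: g); last exact: is_deriveZ.
by near=> t; apply: (@is_deriveZ _ _ _ h a); near: t.
Unshelve. all: by end_near. Qed.

Lemma has_deriv2_sum (R : realType) (m n : nat) (h : nat -> R -> R)
    (c : nat -> R) :
  (forall i, has_deriv2 (h i) (c i)) ->
  has_deriv2 (fun t => \sum_(m <= i < n) h i t) (\sum_(m <= i < n) c i).
Proof.
move=> hc; elim: (index_iota m n) => [|i s IHs].
  rewrite big_nil (_ : (fun _ => _) = cst 0); last first.
    by apply/funext => t; rewrite big_nil.
  exists (cst 0); last exact: is_derive_cst.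
  by apply: filterE => t; exact: is_derive_cst.
rewrite big_cons (_ : (fun _ => _) =
    fun t => h i t + \sum_(j <- s) h j t); last first.
  by apply/funext => t; rewrite big_cons.
exact: has_deriv2D.
Qed.

(** With equal directions the two parameters enter only through their sum, so the mixed partial
    derivative is an ordinary second derivative along [u]. *)
Lemma second_variation_diag (R : realType) (E : (int -> 'rV[R]_2) -> R)
    (y u : int -> 'rV[R]_2) (c : R) :
  has_deriv2 (fun t => E (fun l => y l + t *: u l)) c ->
  second_variation E y u u = c.
Proof.
set h := fun t => _ => -[g hg g0]; rewrite /second_variation derive1E.
have -> : c = 'D_1 g 0 by rewrite derive_val.
apply: near_eq_derive; near=> s.
have [hs Dhs] : is_derive s 1 h (g s) by near: s.
(* For fixed [s] the inner map is [h] shifted by [s], so its derivative at 0 is that of [h] at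
   [s]. *)
rewrite (_ : (fun t => _) = h \o shift s); last first.
  apply/funext => t; rewrite /h /=; congr E; apply/funext => l.
  by rewrite addrC scalerDl addrCA addrA.
have := @derive1_comp R (shift s) h 0.
have [ds Dds] := is_derive_shift (0 : R) 1 s.
by rewrite /= add0r => -> //; rewrite !derive1E Dhs Dds mulr1.
Unshelve. all: by end_near. Qed.

(** * Second-order expansion of one bond *)

Lemma enorm_sqr (R : realType) (v : 'rV[R]_2) :
  enorm v ^+ 2 = v 0 0 ^+ 2 + v 0 1 ^+ 2.
Proof.
rewrite sqr_sqrtr; last by apply: sumr_ge0 => j _; exact: sqr_ge0.
rewrite big_ord_recr big_ord1 /=.
by congr (v 0 _ ^+ 2 + v 0 _ ^+ 2); exact: val_inj.
Qed.

Lemma is_derive_affine (R : realType) (a b t : R) :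
  is_derive t (1 : R) (fun t => a + t * b) b.
Proof.
rewrite (_ : (fun _ => _) = cst a + b \*: id); last first.
  by apply/funext => s; rewrite /cst !fctE /= mulrC.
by apply: is_derive_eq; rewrite add0r [LHS]mulr1.
Qed.

Lemma is_derive_radius (R : realType) (r p q t : R) :
  0 < (r + t * p) ^+ 2 + (t * q) ^+ 2 ->
  let rho (t : R) := Num.sqrt ((r + t * p) ^+ 2 + (t * q) ^+ 2) in
  is_derive t (1 : R) rho (((r + t * p) * p + t * q ^+ 2) / rho t).
Proof.
move=> S_gt0 rho.
have D1 := is_derive_affine r p t; have := is_derive_affine 0 q t.
rewrite (_ : (fun _ => _) = *%R^~ q); last first.
  by apply/funext => s; rewrite add0r.
move=> D2.
have DS := is_deriveD (is_deriveX 2 D1) (is_deriveX 2 D2).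
have := @is_derive1_comp R Num.sqrt
  (fun t => (r + t * p) ^+ 2 + (t * q) ^+ 2) t _ _ (is_derive1_sqrt S_gt0) DS.
move=> /is_derive_eq; apply.
rewrite -/(rho t) /= !expr1 /GRing.scale /=.
have : rho t != 0 by rewrite gt_eqF // sqrtr_gt0.
by move=> ?; field.
Qed.

(** The perturbed length rho satisfies rho'(0) = p and rho''(0) = q^2 / r; the chain rule does the
    rest. *)
Lemma has_deriv2_bond (R : realType) (phi : R -> R) (r p q : R) :
  0 < r -> (forall x : R, 0 < x -> derivable phi x 1) ->
  derivable phi^`() r 1 ->
  has_deriv2 (fun t => phi (Num.sqrt ((r + t * p) ^+ 2 + (t * q) ^+ 2)))
    (phi^`(2)%classic r * p ^+ 2 + phi^`()%classic r / r * q ^+ 2).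
Proof.
move=> r_gt0 dphi ddphi.
pose rho (t : R) := Num.sqrt ((r + t * p) ^+ 2 + (t * q) ^+ 2).
pose num (t : R) := (r * p) + t * (p ^+ 2 + q ^+ 2).
have numE t : (r + t * p) * p + t * q ^+ 2 = num t by rewrite /num; ring.
have rho0 : rho 0 = r.
  by rewrite /rho !mul0r addr0 expr0n addr0 sqrtr_sqr gtr0_norm.
have Drho t : 0 < (r + t * p) ^+ 2 + (t * q) ^+ 2 ->
    is_derive t (1 : R) rho (num t / rho t).
  by move=> /is_derive_radius; rewrite numE.
exists (fun t => phi^`()%classic (rho t) * (num t * (rho t)^-1)).
  (* The longitudinal component stays positive for small [t], so the square root and [phi] are both
     differentiated at positive arguments. *)
  have : \forall t \near (0 : R), 0 < r + t * p.
    have /differentiable_continuous : differentiable (fun t : R => r + t * p) 0.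
      by apply/derivable1_diffP; case: (is_derive_affine r p 0).
    by move=> /cvgr_gt; apply; rewrite mul0r addr0.
  apply: filterS => t rt_gt0.
  have S_gt0 : 0 < (r + t * p) ^+ 2 + (t * q) ^+ 2.
    by rewrite ltr_wpDr ?sqr_ge0 ?exprn_gt0.
  have rho_gt0 : 0 < rho t by rewrite sqrtr_gt0.
  apply: (is_derive1_comp _ (Drho _ S_gt0)).
  by rewrite derive1E; apply: derivableP; exact: dphi.
have S0_gt0 : 0 < (r + 0 * p) ^+ 2 + (0 * q) ^+ 2.
  by rewrite !mul0r addr0 expr0n addr0 exprn_gt0.
have D0 := Drho _ S0_gt0.
have Dnum : is_derive 0 (1 : R) num _ := is_derive_affine _ _ _.
have rho0_neq0 : rho 0 != 0 by rewrite rho0 gt_eqF.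
have Dphi : is_derive (rho 0) (1 : R) phi^`() (phi^`(2)%classic r).
  by rewrite rho0 derive1nS derive1n1 derive1E; exact: derivableP.
have := @is_deriveM _ _ (fun t => phi^`()%classic (rho t))
  (fun t => num t * (rho t)^-1) 0 1 _ _ (is_derive1_comp Dphi D0)
  (is_deriveM Dnum (is_deriveV rho0_neq0 D0)).
move=> /is_derive_eq; apply.
rewrite /= rho0 /num mul0r addr0 /GRing.scale /=.
by field; rewrite gt_eqF.
Qed.

(** * The second variation at the straight chain *)

Lemma enormE (R : realType) (v : 'rV[R]_2) :
  enorm v = Num.sqrt (v 0 0 ^+ 2 + v 0 1 ^+ 2).
Proof. by rewrite -enorm_sqr sqrtr_sqr ger0_norm // sqrtr_ge0. Qed.

(** Makes the local terms bonds with vector [2 *: v], so that one expansion covers all three sums of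
    the energy. *)
Lemma enormZ2 (R : realType) (v : 'rV[R]_2) : 2 * enorm v = enorm (2 *: v).
Proof.
rewrite !enormE !mxE !exprMn -mulrDr sqrtrM ?exprn_ge0 ?ler0n //.
by rewrite sqrtr_sqr ger0_norm ?ler0n.
Qed.

Lemma bdiff_straightD (R : realType) (F t : R) (N : nat)
    (u : int -> 'rV[R]_2) (l : int) : (0 < N)%N ->
  bdiff N (fun l => straight F N l + t *: u l) l =
  F *: delta_mx 0 0 + t *: bdiff N u l.
Proof.
move=> N_gt0; apply/rowP => j; rewrite !mxE !eqxx /=.
have N_neq0 : (N%:R : R) != 0 by rewrite pnatr_eq0 -lt0n.
by rewrite /eps; case: (j == 0) => /=; rewrite ?intrB; field.
Qed.

(** For [r > 0] this is the Hessian of phi(|x|) at x = (r, 0): curvature phi'' along the bond and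
    phi'/r across it. *)
Definition bond_form (R : realType) (phi : R -> R) (r : R) (w : 'rV[R]_2) : R :=
  phi^`(2)%classic r * w 0 0 ^+ 2 + phi^`()%classic r / r * w 0 1 ^+ 2.

Lemma has_deriv2_bond_enorm (R : realType) (phi : R -> R) (r : R)
    (w : 'rV[R]_2) :
  0 < r -> (forall x : R, 0 < x -> derivable phi x 1) ->
  derivable phi^`() r 1 ->
  has_deriv2 (fun t => phi (enorm (r *: delta_mx 0 0 + t *: w)))
    (bond_form phi r w).
Proof.
move=> r_gt0 dphi ddphi; have := has_deriv2_bond (w 0 0) (w 0 1) r_gt0 dphi ddphi.
congr has_deriv2; apply/funext => t; rewrite enormE !mxE /=.
by rewrite mulr1 mulr0 add0r.
Qed.

(** Every bond vector of the straight chain lies on the first axis, with length [F] for nearest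
    neighbors and [2 * F] in the other two sums; each contributes its Hessian. *)
Lemma second_variation_qnl (R : realType) (phi : R -> R) (F : R) (N K : nat)
    (u : int -> 'rV[R]_2) :
  0 < F -> (forall x : R, 0 < x -> derivable phi x 1) ->
  (forall x : R, 0 < x -> derivable phi^`() x 1) -> (0 < N)%N ->
  let v := bdiff N u in
  second_variation (energy_qnl phi N K) (straight F N) u u =
  eps N * \sum_(1 <= l < N.+1) bond_form phi F (v l) +
  eps N * \sum_(1 <= l < K.+1) bond_form phi (2 * F) (v l.+1 + v l) +
  eps N * \sum_(K.+1 <= l < N.+1)
    2^-1 * (bond_form phi (2 * F) (2 *: v l) +
            bond_form phi (2 * F) (2 *: v l.+1)).
Proof.
move=> F_gt0 dphi ddphi N_gt0 v; apply: second_variation_diag.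
have F2_gt0 : 0 < 2 * F by rewrite mulr_gt0 ?ltr0n.
have leaf r (w : 'rV[R]_2) (f : R -> 'rV[R]_2) : 0 < r ->
    (forall t, f t = r *: delta_mx 0 0 + t *: w) ->
    has_deriv2 (fun t => phi (enorm (f t))) (bond_form phi r w).
  move=> r_gt0 fE; rewrite (funext fE).
  by apply: has_deriv2_bond_enorm => //; exact: ddphi.
have leaf2 (w : 'rV[R]_2) (f : R -> 'rV[R]_2) :
    (forall t, f t = F *: delta_mx 0 0 + t *: w) ->
    has_deriv2 (fun t => phi (2 * enorm (f t))) (bond_form phi (2 * F) (2 *: w)).
  move=> fE; under eq_fun do rewrite enormZ2; apply: leaf => // t.
  by rewrite fE scalerDr !scalerA (mulrC t).
apply: has_deriv2D; first apply: has_deriv2D.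
- apply: has_deriv2Z; apply: has_deriv2_sum => l; apply: leaf => // t.
  exact: bdiff_straightD.
- apply: has_deriv2Z; apply: has_deriv2_sum => l; apply: leaf => // t.
  by rewrite !bdiff_straightD // addrACA -scalerDl -scalerDr mulr2n mulrDl mul1r.
- apply: has_deriv2Z; apply: has_deriv2_sum => l; apply: has_deriv2Z.
  by apply: has_deriv2D; apply: leaf2 => t; exact: bdiff_straightD.
Qed.

(** Shifting the index costs only the telescoped boundary terms, which later fix the weights of the
    interfacial bonds. *)
Lemma sum_pair (R : realType) (m n : nat) (x : nat -> R) : (m <= n)%N ->
  \sum_(m <= l < n) (x l + x l.+1) = 2 * (\sum_(m <= l < n) x l) + x n - x m.
Proof.
move=> mn; rewrite -addrA -telescope_sumr // mulr_sumr -big_split /=.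
by apply: eq_bigr => l _; ring.
Qed.

(* The completed square [a'^2 + a^2 = ((a' + a)^2 + (a' - a)^2) / 2] turns the
   longitudinal part into a multiple of the full norm plus a nonnegative rest. *)
Lemma second_variation_qnlE (R : realType) (phi : R -> R) (F : R) (N K : nat)
    (u : int -> 'rV[R]_2) :
  0 < F -> (forall x : R, 0 < x -> derivable phi x 1) ->
  (forall x : R, 0 < x -> derivable phi^`() x 1) -> (K < N)%N ->
  (forall l : int, u (l + N%:Z) = u l) ->
  let a (l : nat) := bdiff N u l 0 0 in
  let b (l : nat) := bdiff N u l 0 1 in
  second_variation (energy_qnl phi N K) (straight F N) u u =
  eps N * (
    (phi^`(2)%classic F + 4 * phi^`(2)%classic (2 * F)) *
      (\sum_(1 <= l < N.+1) a l ^+ 2) -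
    phi^`(2)%classic (2 * F) * (\sum_(1 <= l < K.+1) (a l.+1 - a l) ^+ 2) +
    phi^`()%classic F / F * (\sum_(1 <= l < N.+1) b l ^+ 2) +
    phi^`()%classic (2 * F) / F *
      (2 * (\sum_(K.+2 <= l < N.+1) b l ^+ 2) + b 1%N ^+ 2 + b K.+1 ^+ 2 +
       2^-1 * (\sum_(1 <= l < K.+1) (b l.+1 + b l) ^+ 2))).
Proof.
move=> F_gt0 dphi ddphi KN uper a b.
have F_neq0 : F != 0 by rewrite gt_eqF.
(* The local sum reaches bond [N.+1], which periodicity identifies with bond 1. *)
have perE (j : 'I_2) : bdiff N u N.+1 0 j = bdiff N u 1%N 0 j.
  rewrite /bdiff !mxE (_ : Posz N.+1 = 1 + N%:Z); last by lia.
  by rewrite addrAC !uper.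
rewrite second_variation_qnl //; last exact: leq_ltn_trans KN.
rewrite -!mulrDr; congr (_ * _).
set D := phi^`(2)%classic; set d := phi^`()%classic.
have -> : \sum_(1 <= l < N.+1) bond_form phi F (bdiff N u l) =
    D F * (\sum_(1 <= l < N.+1) a l ^+ 2) + d F / F * (\sum_(1 <= l < N.+1) b l ^+ 2).
  by rewrite !mulr_sumr -big_split.
(* Only the longitudinal square is expanded; the transversal one is kept, with weight
   phi'(2F)/(2F). *)
have -> : \sum_(1 <= l < K.+1)
      bond_form phi (2 * F) (bdiff N u l.+1 + bdiff N u l) =
    D (2 * F) * (2 * (\sum_(1 <= l < K.+1) (a l ^+ 2 + a l.+1 ^+ 2)) -
                 \sum_(1 <= l < K.+1) (a l.+1 - a l) ^+ 2) +
    d (2 * F) / F * (2^-1 * (\sum_(1 <= l < K.+1) (b l.+1 + b l) ^+ 2)).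
  rewrite !mulr_sumr -sumrB mulr_sumr -big_split /=; apply: eq_bigr => l _.
  rewrite /a /b; move: (bdiff N u l) (bdiff N u l.+1) => v w.
  by rewrite /bond_form !mxE -/d -/D; field.
(* The factor 1/2 and the 4 from squaring the doubled strain give the weights 2 phi''(2F) and
   phi'(2F)/F. *)
have -> : \sum_(K.+1 <= l < N.+1) 2^-1 *
      (bond_form phi (2 * F) (2 *: bdiff N u l) +
       bond_form phi (2 * F) (2 *: bdiff N u l.+1)) =
    2 * D (2 * F) * (\sum_(K.+1 <= l < N.+1) (a l ^+ 2 + a l.+1 ^+ 2)) +
    d (2 * F) / F * (\sum_(K.+1 <= l < N.+1) (b l ^+ 2 + b l.+1 ^+ 2)).
  rewrite !mulr_sumr -big_split /=; apply: eq_bigr => l _.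
  rewrite /a /b; move: (bdiff N u l) (bdiff N u l.+1) => v w.
  by rewrite /bond_form !mxE -/d -/D; field.
rewrite !(sum_pair (fun l => a l ^+ 2)) ?(sum_pair (fun l => b l ^+ 2)) //;
  try by lia.
(* The boundary terms lower the transversal weight of bond [K.+1] from 2 to 1 and give weight 1 to
   bond 1. Their longitudinal counterparts from the two regions cancel. *)
rewrite [X in _ + d (2 * F) / F * (2 * X + _ - _)]big_ltn; last by lia.
rewrite [in RHS](@big_cat_nat _ _ _ K.+1) //=; last by lia.
rewrite [X in D F * X](@big_cat_nat _ _ _ K.+1) //=; last by lia.
by rewrite /a /b !perE; field.
Qed.

(** * Lower bounds region by region *)

Lemma eps_gt0 (R : realType) (N : nat) : (0 < N)%N -> 0 < eps N :> R.
Proof. by move=> N_gt0; rewrite invr_gt0 ltr0n. Qed.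

Lemma sum_enorm_sqr (R : realType) (m n : nat) (v : nat -> 'rV[R]_2) :
  \sum_(m <= l < n) enorm (v l) ^+ 2 =
  \sum_(m <= l < n) v l 0 0 ^+ 2 + \sum_(m <= l < n) v l 0 1 ^+ 2.
Proof. by rewrite -big_split; apply: eq_bigr => l _; exact: enorm_sqr. Qed.

Lemma sum_sqr_ge0 (R : realType) (m n : nat) (x : nat -> R) :
  0 <= \sum_(m <= l < n) x l ^+ 2.
Proof. by apply: sumr_ge0 => l _; exact: sqr_ge0. Qed.

Lemma l2norm_sqr (R : realType) (N : nat) (v : int -> 'rV[R]_2) :
  l2norm N v ^+ 2 =
  eps N * (\sum_(1 <= l < N.+1) v l 0 0 ^+ 2 + \sum_(1 <= l < N.+1) v l 0 1 ^+ 2).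
Proof.
rewrite -sum_enorm_sqr sqr_sqrtr // mulr_ge0 ?invr_ge0 //.
exact: sum_sqr_ge0.
Qed.

Lemma l2norm_A_sqr (R : realType) (N K : nat) (v : int -> 'rV[R]_2) :
  l2norm_A N K v ^+ 2 =
  eps N * (\sum_(2 <= l < K.+1) v l 0 0 ^+ 2 + \sum_(2 <= l < K.+1) v l 0 1 ^+ 2).
Proof.
rewrite -sum_enorm_sqr sqr_sqrtr // mulr_ge0 ?invr_ge0 //.
exact: sum_sqr_ge0.
Qed.

Lemma l2norm_C_sqr (R : realType) (N K : nat) (v : int -> 'rV[R]_2) :
  l2norm_C N K v ^+ 2 =
  eps N * (\sum_(K.+2 <= l < N.+1) v l 0 0 ^+ 2 +
           \sum_(K.+2 <= l < N.+1) v l 0 1 ^+ 2).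
Proof.
rewrite -sum_enorm_sqr sqr_sqrtr // mulr_ge0 ?invr_ge0 //.
exact: sum_sqr_ge0.
Qed.

Lemma l2norm_I_sqr (R : realType) (N K : nat) (v : int -> 'rV[R]_2) :
  l2norm_I N K v ^+ 2 =
  eps N * (v 1%N 0 0 ^+ 2 + v K.+1 0 0 ^+ 2 + (v 1%N 0 1 ^+ 2 + v K.+1 0 1 ^+ 2)).
Proof.
rewrite sqr_sqrtr; last by rewrite addr_ge0 // mulr_ge0 ?invr_ge0 ?sqr_ge0.
by rewrite -mulrDr !enorm_sqr addrACA.
Qed.

Lemma sum_split_regions (R : realType) (N K : nat) (x : nat -> R) :
  (1 < K < N)%N ->
  \sum_(1 <= l < N.+1) x l =
  x 1%N + x K.+1 + \sum_(2 <= l < K.+1) x l + \sum_(K.+2 <= l < N.+1) x l.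
Proof.
move=> KN; rewrite big_ltn; last by lia.
rewrite (@big_cat_nat _ _ _ K.+1) /=; [|lia|lia].
rewrite [X in _ + (_ + X)]big_ltn; last by lia.
by ring.
Qed.

(** In the decomposed form the longitudinal coefficient is the same on every bond, while the
    transversal one exceeds phi'(F)/F by 0, 2 or 1 times phi'(2F)/F on nonlocal, local and
    interfacial bonds. Each minimum is below both coefficients of its region. *)
Lemma qnl_stability (R : realType) (phi : R -> R) (F : R) (N K : nat)
    (u : int -> 'rV[R]_2) :
  0 < F -> (forall x : R, 0 < x -> derivable phi x 1) ->
  (forall x : R, 0 < x -> derivable phi^`() x 1) ->
  0 <= phi^`()%classic (2 * F) -> phi^`(2)%classic (2 * F) <= 0 ->
  (1 < K < N)%N -> displacements N u ->
  let d : R -> R := phi^`() in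
  let D : R -> R := phi^`(2) in
  let bound :=
    Num.min (D F + 4 * D (2 * F)) (d F / F) * l2norm_A N K (bdiff N u) ^+ 2 +
    Num.min (D F + 4 * D (2 * F)) ((d F + 2 * d (2 * F)) / F)
      * l2norm_C N K (bdiff N u) ^+ 2 +
    Num.min (D F + 4 * D (2 * F)) ((d F + d (2 * F)) / F)
      * l2norm_I N K (bdiff N u) ^+ 2 in
  bound <= second_variation (energy_qnl phi N K) (straight F N) u u /\
  Num.min (D F + 4 * D (2 * F)) (d F / F) * l2norm N (bdiff N u) ^+ 2 <= bound.
Proof.
move=> F_gt0 dphi ddphi d_ge0 D_le0 KN [uper _] d D bound.
have N_gt0 : (0 < N)%N by lia.
have e_gt0 := @eps_gt0 R N N_gt0.
rewrite /bound second_variation_qnlE //; last by lia.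
rewrite l2norm_A_sqr l2norm_C_sqr l2norm_I_sqr l2norm_sqr.
rewrite -/(D _) in D_le0; rewrite -/d -/D !(@sum_split_regions _ N K) //.
have be_ge0 : 0 <= d (2 * F) / F by rewrite divr_ge0 // ltW.
rewrite !(mulrDl _ _ F^-1) -(mulrA 2).
move: (D F + _) => A; move: (d F / F) => B.
move: (d (2 * F) / F) be_ge0 => be be_ge0; move: (D (2 * F)) D_le0 => D2 D2_le0.
set m1 := Num.min A B; set m2 := Num.min A (_ + _); set m3 := Num.min A (_ + _).
have [m1A m1B] : m1 <= A /\ m1 <= B by rewrite /m1; split; rewrite ge_min lexx ?orbT.
have [m2A m2B] : m2 <= A /\ m2 <= B + 2 * be.
  by rewrite /m2; split; rewrite ge_min lexx ?orbT.
have [m3A m3B] : m3 <= A /\ m3 <= B + be.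
  by rewrite /m3; split; rewrite ge_min lexx ?orbT.
(* Here phi'(2F) >= 0 makes the nonlocal minimum the smallest, which yields the second
   inequality. *)
have m12 : m1 <= m2 by rewrite /m2 le_min m1A /=; lra.
have m13 : m1 <= m3 by rewrite /m3 le_min m1A /=; lra.
clearbody m1 m2 m3; rewrite ![_ * (eps N * _)]mulrCA -!mulrDr !ler_pM2l //.
have := sqr_ge0 (bdiff N u 1%N 0 0); have := sqr_ge0 (bdiff N u K.+1 0 0).
have := sqr_ge0 (bdiff N u 1%N 0 1); have := sqr_ge0 (bdiff N u K.+1 0 1).
have := sum_sqr_ge0 2 K.+1 (fun l => bdiff N u l 0 0).
have := sum_sqr_ge0 2 K.+1 (fun l => bdiff N u l 0 1).
have := sum_sqr_ge0 K.+2 N.+1 (fun l => bdiff N u l 0 0).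
have := sum_sqr_ge0 K.+2 N.+1 (fun l => bdiff N u l 0 1).
have := sum_sqr_ge0 1 K.+1 (fun l => bdiff N u l.+1 0 0 - bdiff N u l 0 0).
have := sum_sqr_ge0 1 K.+1 (fun l => bdiff N u l.+1 0 1 + bdiff N u l 0 1).
rewrite /=.
move: (\sum_(_ <= _ < _) _) => T'.
move: (\sum_(_ <= _ < _) _) => T.
move: (\sum_(_ <= _ < _) _) => bC.
move: (\sum_(_ <= _ < _) _) => aC.
move: (\sum_(_ <= _ < _) _) => bA.
move: (\sum_(_ <= _ < _) _) => aA.
move: (_ ^+ 2) => b2; move: (_ ^+ 2) => b1; move: (_ ^+ 2) => a2.
move: (_ ^+ 2) => a1 T'_ge0 T_ge0 bC_ge0 aC_ge0 bA_ge0 aA_ge0 b2_ge0 b1_ge0 a2_ge0 a1_ge0.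
(* The sign conditions on phi''(2F) and phi'(2F) allow both rest sums to be dropped. *)
have DT : D2 * T <= 0 by rewrite mulr_le0_ge0.
have beT : 0 <= be * T' by rewrite mulr_ge0.
have M (x y z : R) : 0 <= z -> x <= y -> x * z <= y * z by move=> *; rewrite ler_wpM2r.
split.
- have := M _ _ _ aA_ge0 m1A; have := M _ _ _ bA_ge0 m1B.
  have := M _ _ _ aC_ge0 m2A; have := M _ _ _ bC_ge0 m2B.
  have := M _ _ _ a1_ge0 m3A; have := M _ _ _ b1_ge0 m3B.
  have := M _ _ _ a2_ge0 m3A; have := M _ _ _ b2_ge0 m3B.
  lra.
- have := M _ _ _ aC_ge0 m12; have := M _ _ _ bC_ge0 m12.
  have := M _ _ _ a1_ge0 m13; have := M _ _ _ b1_ge0 m13.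
  have := M _ _ _ a2_ge0 m13; have := M _ _ _ b2_ge0 m13.
  lra.
Qed.

(** * Recovering displacements from strains *)

Lemma periodic_modz (T : Type) (N : nat) (u : int -> T) (l : int) :
  (forall l : int, u (l + N%:Z) = u l) -> u (l %% N)%Z = u l.
Proof.
move=> uper; have perM (n : nat) (k : int) : u (k + n%:Z * N%:Z) = u k.
  elim: n => [|n IHn]; first by rewrite mul0r addr0.
  by rewrite -[n.+1]addn1 PoszD mulrDl mul1r addrA uper.
rewrite [in RHS](divz_eq l N) addrC; case: (l %/ N)%Z => n; first by rewrite perM.
by rewrite -(perM n.+1 (_ + Negz n * _)) NegzE mulNr subrK.
Qed.

(** Zero strain makes [u] constant and zero mean makes the constant vanish; hence the quotients
    below have nonzero denominators. *)
Lemma displacement_eq0 (R : realType) (N : nat) (u : int -> 'rV[R]_2) :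
  (0 < N)%N -> displacements N u ->
  (forall l : nat, (0 < l <= N)%N -> bdiff N u l = 0) -> u = fun=> 0.
Proof.
move=> N_gt0 [uper u_sum0] du0.
have u_cst (l : nat) : (l <= N)%N -> u l = u 0.
  elim: l => // l IHl lN; rewrite -IHl; last exact: ltnW.
  apply/eqP; rewrite -subr_eq0; move/eqP: (du0 l.+1 lN).
  rewrite scaler_eq0 invr_eq0 gt_eqF ?eps_gt0 //=.
  by rewrite (_ : Posz l.+1 - 1 = l) //; lia.
have u0 : u 0 = 0.
  apply/eqP; move/eqP: u_sum0.
  rewrite (eq_big_nat _ _ (F2 := fun=> u 0)); last by move=> l lN; apply: u_cst; lia.
  rewrite sumr_const_nat subn1 /= -scaler_nat scaler_eq0 pnatr_eq0.
  by rewrite eqn0Ngt N_gt0.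
apply/funext => l; rewrite -(periodic_modz l uper) -[RHS]u0.
have: (0 <= (l %% N)%Z < N%:Z) by rewrite modz_ge0 ?ltz_pmod //; lia.
by case: (l %% N)%Z => // n /andP[_ nN]; apply: u_cst; lia.
Qed.

(** Discrete integration: the partial sums close up periodically because the total is zero, and
    subtracting their mean leaves the differences unchanged. *)
Lemma displacement_of_bdiff (R : realType) (N : nat) (b : nat -> 'rV[R]_2) :
  (0 < N)%N -> \sum_(1 <= l < N.+1) b l = 0 ->
  exists2 u, displacements N u &
             forall l : nat, (0 < l <= N)%N -> bdiff N u l = b l.
Proof.
move=> N_gt0 b_sum0.
pose w (n : nat) := eps N *: \sum_(1 <= j < n.+1) b j.
pose w' (l : int) := w `|(l %% N)%Z|%N.
exists (fun l => w' l - eps N *: \sum_(1 <= j < N.+1) w' j).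
  split=> [l|]; first by rewrite /w' modzDr.
  rewrite sumrB sumr_const_nat subn1 /= -scaler_nat scalerA divff ?scale1r ?subrr //.
  by rewrite pnatr_eq0 -lt0n.
(* At [l = N] the remainder is 0, and both [w 0] and [w N] vanish. *)
have w'E (l : nat) : (l <= N)%N -> w' l = w l.
  rewrite leq_eqVlt => /predU1P[->|lN]; last by rewrite /w' modz_nat modn_small.
  by rewrite /w' modzz /w b_sum0 big_geq.
move=> [//|l] /andP[_ lN]; rewrite /bdiff.
rewrite (_ : Posz l.+1 - 1 = l); last by lia.
rewrite opprB addrA subrK !w'E //; last exact: ltnW.
rewrite /w -scalerBr scalerA mulVf ?gt_eqF ?eps_gt0 // scale1r.
by rewrite big_nat_recr //= addrAC subrr add0r.
Qed.

(** * Test displacements for the upper bounds *)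

Lemma sum_nat_eq0 (R : realType) (m n : nat) (f : nat -> R) :
  (forall l, (m <= l < n)%N -> f l = 0) -> \sum_(m <= l < n) f l = 0.
Proof. by move=> f0; rewrite big_nat big1. Qed.

Lemma sum_nat_if (R : realType) (m n p q : nat) (f : nat -> R) :
  (m <= p)%N -> (q <= n)%N ->
  \sum_(m <= l < n) (if (p <= l < q)%N then f l else 0) = \sum_(p <= l < q) f l.
Proof.
move=> mp qn; by rewrite -big_mkcond [RHS](big_nat_widenl _ m) // [RHS](big_nat_widen _ _ n).
Qed.

(** Unit strain on bonds [1 .. K.+1] annihilates every difference in the rest sum. The single local
    bond [K.+2], available since [K.+1 < N], restores the zero sum. *)
Lemma longitudinal_test (R : realType) (phi : R -> R) (F : R) (N K : nat) :
  0 < F -> (forall x : R, 0 < x -> derivable phi x 1) ->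
  (forall x : R, 0 < x -> derivable phi^`() x 1) -> (K.+1 < N)%N ->
  exists2 u, (displacements N `\ (fun=> 0)) u &
    second_variation (energy_qnl phi N K) (straight F N) u u
      / l2norm N (bdiff N u) ^+ 2
    = phi^`(2)%classic F + 4 * phi^`(2)%classic (2 * F).
Proof.
move=> F_gt0 dphi ddphi KN.
pose a (l : nat) : R :=
  if (l <= K.+1)%N then 1 else if l == K.+2 then - K.+1%:R else 0.
have a_sum0 : \sum_(1 <= l < N.+1) a l = 0.
  rewrite (@big_cat_nat _ _ _ K.+2) /=; [|lia|lia].
  rewrite [X in _ + X]big_ltn; last by lia.
  rewrite (eq_big_nat _ _ (F2 := fun=> 1)); last first.
    by move=> l lK; rewrite /a ifT //; lia.
  rewrite sumr_const_nat subn1 sum_nat_eq0; last first.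
    by move=> l lK; rewrite /a !ifF //; lia.
  by rewrite /a ltnn eqxx addr0 subrr.
have N_gt0 : (0 < N)%N by lia.
have [|u uU uE] := @displacement_of_bdiff R N (fun l => a l *: delta_mx 0 0) N_gt0.
  by rewrite -scaler_suml a_sum0 scale0r.
have aE (l : nat) : (0 < l <= N)%N -> bdiff N u l 0 0 = a l.
  by move=> /uE ->; rewrite !mxE mulr1.
have bE (l : nat) : (0 < l <= N)%N -> bdiff N u l 0 1 = 0.
  by move=> /uE ->; rewrite !mxE mulr0.
have asq_gt0 : 0 < \sum_(1 <= l < N.+1) a l ^+ 2.
  rewrite big_ltn //; apply: ltr_pwDl; last exact: sum_sqr_ge0.
  by rewrite /a /= expr1n.
exists u.
  split=> // u0; have := aE 1%N; rewrite u0 /bdiff subrr scaler0 mxE /a /=.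
  by move=> /(_ N_gt0) /esym/eqP; rewrite oner_eq0.
have sum_b0 (m n : nat) : (0 < m)%N -> (n <= N.+1)%N ->
    \sum_(m <= l < n) bdiff N u l 0 1 ^+ 2 = 0.
  move=> m_gt0 nN; apply: sum_nat_eq0 => l lmn.
  by rewrite bE ?expr0n //; lia.
have a_diff0 : \sum_(1 <= l < K.+1)
    (bdiff N u l.+1 0 0 - bdiff N u l 0 0) ^+ 2 = 0.
  apply: sum_nat_eq0 => l lK; rewrite !aE; [|lia..].
  by rewrite /a !ifT ?subrr ?expr0n //; lia.
have b_pair0 : \sum_(1 <= l < K.+1)
    (bdiff N u l.+1 0 1 + bdiff N u l 0 1) ^+ 2 = 0.
  by apply: sum_nat_eq0 => l lK; rewrite !bE ?addr0 ?expr0n //; lia.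
have asqE : \sum_(1 <= l < N.+1) bdiff N u l 0 0 ^+ 2 =
    \sum_(1 <= l < N.+1) a l ^+ 2.
  by apply: eq_big_nat => l lN; rewrite aE //; lia.
rewrite second_variation_qnlE //; [|lia|by case: uU].
rewrite l2norm_sqr asqE a_diff0 b_pair0 !sum_b0 // !bE; [|lia..].
have e_neq0 : eps N != 0 :> R by rewrite gt_eqF // eps_gt0.
rewrite expr0n !mulr0 !addr0 !mulr0 subr0 !addr0 invfM mulrACA divff // mul1r.
by rewrite mulfK // gt_eqF.
Qed.

(* The oscillation stays on the bonds [2 .. 2m+1], hence inside the nonlocal
   region, where second neighbors do not see it except at its two ends. *)
Lemma transversal_test (R : realType) (phi : R -> R) (F : R) (N K m : nat) :
  0 < F -> (forall x : R, 0 < x -> derivable phi x 1) ->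
  (forall x : R, 0 < x -> derivable phi^`() x 1) -> (K < N)%N ->
  (0 < m)%N -> (m.*2 < K)%N ->
  exists2 u, (displacements N `\ (fun=> 0)) u &
    second_variation (energy_qnl phi N K) (straight F N) u u
      / l2norm N (bdiff N u) ^+ 2
    = phi^`()%classic F / F + phi^`()%classic (2 * F) / F / m.*2%:R.
Proof.
move=> F_gt0 dphi ddphi KN m_gt0 mK.
(* An even number of alternating signs sums to zero; the support avoids the interfacial bonds 1 and
   [K.+1]. *)
pose b (l : nat) : R := if (2 <= l < m.*2.+2)%N then (-1) ^+ l else 0.
have b_sum0 : \sum_(1 <= l < N.+1) b l = 0.
  rewrite sum_nat_if //; last by lia.
  elim: m {m_gt0 mK b} => [|m IHm]; first by rewrite big_geq.
  rewrite doubleS; do 2 rewrite big_nat_recr //=.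
  by rewrite IHm add0r !exprS; ring.
have bsq_sum : \sum_(1 <= l < N.+1) b l ^+ 2 = m.*2%:R.
  transitivity (\sum_(2 <= l < m.*2.+2) (1 : R)); last first.
    by rewrite sumr_const_nat !subSS subn0.
  rewrite -(@sum_nat_if _ 1 N.+1); [|by []|lia].
  by apply: eq_bigr => l _; rewrite /b; case: ifP => _; rewrite ?sqrr_sign ?expr0n.
(* Neighboring signs cancel; only the pairs straddling an end of the support survive. *)
have b_pair l : (b l.+1 + b l) ^+ 2 = (l == 1%N)%:R + (l == m.*2.+1)%:R.
  rewrite /b; case: (ltngtP l 1%N) => l1.
  - by case: l l1 => // _; rewrite /= addr0 expr0n ?addr0.
  - have -> : (1 < l.+1)%N by lia.
    case: (ltngtP l m.*2.+1) => lm.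
    + have -> : (l.+1 < m.*2.+2)%N by lia.
      have -> : (l < m.*2.+2)%N by lia.
      by rewrite /= [_ ^+ l.+1]exprS mulN1r addNr expr0n addr0.
    + have -> : (l.+1 < m.*2.+2)%N = false by lia.
      have -> : (l < m.*2.+2)%N = false by lia.
      by rewrite /= addr0 expr0n ?addr0.
    + by rewrite lm ltnn ltnSn /= add0r sqrr_sign add0r.
  - rewrite l1 /= ifT; last by lia.
    by rewrite addr0 ?sqrr_sign (_ : (1 == _)%N = false) ?addr0 //; lia.
have N_gt0 : (0 < N)%N by lia.
have [|u uU uE] := @displacement_of_bdiff R N (fun l => b l *: delta_mx 0 1) N_gt0.
  by rewrite -scaler_suml b_sum0 scale0r.
have aE (l : nat) : (0 < l <= N)%N -> bdiff N u l 0 0 = 0.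
  by move=> /uE ->; rewrite !mxE mulr0.
have bE (l : nat) : (0 < l <= N)%N -> bdiff N u l 0 1 = b l.
  by move=> /uE ->; rewrite !mxE mulr1.
exists u.
  split=> // u0; have := bE 2; rewrite u0 /bdiff subrr scaler0 mxE /b ifT; last by lia.
  have N2 : (0 < 2 <= N)%N by lia.
  by rewrite sqrrN expr1n => /(_ N2)/esym/eqP; rewrite oner_eq0.
have bC0 : \sum_(K.+2 <= l < N.+1) bdiff N u l 0 1 ^+ 2 = 0.
  by apply: sum_nat_eq0 => l lK; rewrite bE /b ?ifF ?expr0n //; lia.
have asq0 : \sum_(1 <= l < N.+1) bdiff N u l 0 0 ^+ 2 = 0.
  by apply: sum_nat_eq0 => l lN; rewrite aE ?expr0n //; lia.
have a_diff0 : \sum_(1 <= l < K.+1)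
    (bdiff N u l.+1 0 0 - bdiff N u l 0 0) ^+ 2 = 0.
  by apply: sum_nat_eq0 => l lK; rewrite !aE ?subr0 ?expr0n //; lia.
have bsqE : \sum_(1 <= l < N.+1) bdiff N u l 0 1 ^+ 2 = m.*2%:R.
  by rewrite -bsq_sum; apply: eq_big_nat => l lN; rewrite bE //; lia.
(* Both ends count, since [m.*2.+1 <= K]. Halved, this 2 against the squared norm [m.*2] gives the
   correction phi'(2F)/F divided by [m.*2]. *)
have b_pair_sum : \sum_(1 <= l < K.+1) (bdiff N u l.+1 0 1 + bdiff N u l 0 1) ^+ 2 = 2.
  rewrite (eq_big_nat _ _ (F2 := fun l => (l == 1%N)%:R + (l == m.*2.+1)%:R)).
    rewrite big_split /= -!natr_sum -natrD; congr _%:R.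
    rewrite -!big_mkcond /= !big_nat1_eq.
    by rewrite !ifT //; lia.
  by move=> l lK; rewrite !bE ?b_pair //; lia.
rewrite second_variation_qnlE //; last by case: uU.
rewrite l2norm_sqr bC0 asq0 a_diff0 bsqE b_pair_sum !bE; [|lia..].
rewrite /b /= ifF; last by lia.
have e_neq0 : eps N != 0 :> R by rewrite gt_eqF // eps_gt0.
have m_neq0 : m.*2%:R != 0 :> R by rewrite pnatr_eq0 double_eq0 -lt0n.
rewrite expr0n !mulr0 subr0 !addr0 !add0r mulVf ?pnatr_eq0 // mulr1.
by rewrite invfM mulrACA divff // mul1r mulrDl mulfK.
Qed.

(** * Asymptotics of the infimum *)

Lemma l2norm_bdiff_gt0 (R : realType) (N : nat) (u : int -> 'rV[R]_2) :
  (0 < N)%N -> (displacements N `\ (fun=> 0)) u -> 0 < l2norm N (bdiff N u) ^+ 2.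
Proof.
move=> N_gt0 [uU u_neq0]; rewrite lt_def sqr_ge0 andbT; apply/negP => /eqP n0.
apply: u_neq0; apply: (displacement_eq0 N_gt0 uU) => l lN.
move/eqP: n0; rewrite l2norm_sqr -sum_enorm_sqr mulf_eq0 gt_eqF ?eps_gt0 //=.
rewrite psumr_eq0; last by move=> i _; exact: sqr_ge0.
move=> /allP /(_ l); rewrite mem_index_iota => /(_ lN) /=.
rewrite enorm_sqr paddr_eq0 ?sqr_ge0 // !sqrf_eq0 => /andP[/eqP v0 /eqP v1].
apply/rowP => -[[|[|//]] j_lt2]; rewrite [RHS]mxE.
  by rewrite -v0; congr (bdiff N u l 0 _); exact: val_inj.
by rewrite -v1; congr (bdiff N u l 0 _); exact: val_inj.
Qed.

Theorem theorem10p2 (R : realType) (phi : R -> R) (F : R)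
    (F_gt0 : 0 < F)
    (phi_derivable : forall x : R, 0 < x -> derivable phi x 1)
    (dphi_derivable : forall x : R, 0 < x -> derivable phi^`() x 1)
    (dphi_ge0 : 0 <= phi^`() (2 * F))
    (ddphi_le0 : phi^`(2) (2 * F) <= 0) :
  let dphi : R -> R := phi^`() in
  let ddphi : R -> R := phi^`(2) in
  (forall (N K : nat) (u : int -> 'rV[R]_2),
     (1 < K < N)%N -> displacements N u ->
     let bound :=
       Num.min (ddphi F + 4 * ddphi (2 * F)) (dphi F / F)
         * l2norm_A N K (bdiff N u) ^+ 2 +
       Num.min (ddphi F + 4 * ddphi (2 * F))
               ((dphi F + 2 * dphi (2 * F)) / F)
         * l2norm_C N K (bdiff N u) ^+ 2 +
       Num.min (ddphi F + 4 * ddphi (2 * F))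
               ((dphi F + dphi (2 * F)) / F)
         * l2norm_I N K (bdiff N u) ^+ 2 in
     second_variation (energy_qnl phi N K) (straight F N) u u >= bound /\
     bound >= Num.min (ddphi F + 4 * ddphi (2 * F)) (dphi F / F)
                * l2norm N (bdiff N u) ^+ 2) /\
  (forall (K : nat -> nat) (alpha : R),
     0 < alpha ->
     (\forall N \near \oo, (1 < K N)%N /\ ((K N).+1 < N)%N /\
                           alpha * N%:R <= (K N)%:R) ->
     exists r : nat -> R,
       r =O_\oo (fun N => eps N : R) /\
       \forall N \near \oo,
         inf [set second_variation (energy_qnl phi N (K N)) (straight F N) u u
                    / l2norm N (bdiff N u) ^+ 2
             | u in displacements N `\ (fun=> 0)]
         = Num.min (ddphi F + 4 * ddphi (2 * F)) (dphi F / F + r N)).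
Proof.
move=> dphi ddphi; split=> [N K u|K alpha alpha_gt0 K_near].
  exact: qnl_stability.
pose A := ddphi F + 4 * ddphi (2 * F); pose B := dphi F / F.
pose be := dphi (2 * F) / F.
have be_ge0 : 0 <= be by rewrite divr_ge0 // ltW.
pose Q N := [set second_variation (energy_qnl phi N (K N)) (straight F N) u u
                   / l2norm N (bdiff N u) ^+ 2
            | u in displacements N `\ (fun=> 0)] : set R.
have inf_bounds : \forall N \near \oo,
    [/\ Num.min A B <= inf (Q N), inf (Q N) <= A &
        inf (Q N) <= B + (3 * be / alpha) * eps N].
  (* This threshold forces [K N >= 3], so that an oscillation with [m >= 1] fits. *)
  have N_large : \forall N \near \oo, 3 / alpha <= N%:R :> R.
    exact: nbhs_infty_ger.
  near=> N.
  have [K_gt1 [KN aK]] : (1 < K N)%N /\ ((K N).+1 < N)%N /\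
      alpha * N%:R <= (K N)%:R by near: N.
  have Nl : 3 / alpha <= N%:R :> R by near: N.
  have K_ge3 : (2 < K N)%N.
    by rewrite -(ler_nat R) (le_trans _ aK) // mulrC -ler_pdivrMr.
  have KN' : (1 < K N < N)%N by lia.
  have N_gt0 : (0 < N)%N by lia.
  have lbQ : lbound (Q N) (Num.min A B).
    move=> _ [u uU0 <-]; have norm_gt0 := l2norm_bdiff_gt0 N_gt0 uU0.
    case: uU0 => uU _.
    have [le1 le2] := qnl_stability F_gt0 phi_derivable dphi_derivable dphi_ge0
      ddphi_le0 KN' uU.
    by rewrite ler_pdivlMr // (le_trans le2).
  have QA : Q N A.
    have [u uU uE] := longitudinal_test F_gt0 phi_derivable dphi_derivable KN.
    by exists u.
  have hQ : has_lbound (Q N) by exists (Num.min A B).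
  split; [by apply: lb_le_inf => //; exists A|exact: ge_inf|].
  (* The largest [m] with [m.*2 < K N]. *)
  have m_gt0 : (0 < (K N).-1./2)%N by lia.
  have mK : ((K N).-1./2.*2 < K N)%N by lia.
  have KN1 : (K N < N)%N by lia.
  have [u uU uE] := transversal_test F_gt0 phi_derivable dphi_derivable KN1
    m_gt0 mK.
  apply: (@le_trans _ _ (B + be / (K N).-1./2.*2%:R)).
    by apply: ge_inf => //; exists u.
  (* For K >= 3 one has 2m >= K - 2 >= K/3, so be/(2m) <= 3 be/K <= (3 be/alpha) eps. *)
  have -> : 3 * be / alpha * eps N = be * (3 * (alpha^-1 * eps N)) by ring.
  rewrite lerD2l ler_wpM2l // /eps -invfM.
  rewrite ler_pdivlMr ?mulr_gt0 ?ltr0n //.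
  rewrite mulrC ler_pdivrMr ?ltr0n ?double_gt0 // (le_trans aK) //.
  by rewrite -natrM ler_nat; lia.
have C_ge0 : 0 <= 3 * be / alpha.
  by apply: divr_ge0 (ltW alpha_gt0); rewrite mulr_ge0 ?ler0n.
(* The excess of the infimum over [B], cut off at 0 because the infimum may equal [A] below [B]. *)
exists (fun N => Num.max 0 (inf (Q N) - B)); split.
  (* The added 1 keeps the constant positive even when [be] vanishes. *)
  apply/eqO_exP; exists (3 * be / alpha + 1); first by rewrite ltr_wpDl.
  apply: filterS inf_bounds => N [_ _ infB].
  have e_ge0 : 0 <= eps N :> R by rewrite invr_ge0.
  rewrite (ger0_norm e_ge0) ger0_norm; last by rewrite le_max lexx.
  rewrite ge_max mulr_ge0 ?addr_ge0 //= lerBlDl (le_trans infB) // lerD2l.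
  by rewrite ler_wpM2r // lerDl.
apply: filterS inf_bounds => N [ABinf infA _].
apply/eqP; rewrite -/(Q N) -/A -/B eq_le ge_min le_min infA /=.
(* If the infimum is at most [B], it is squeezed to [Num.min A B]; otherwise [B] plus the excess is
   the infimum itself, which is at most [A]. *)
have [infB|Binf] := leP (inf (Q N)) B.
  by rewrite max_l ?subr_le0 // addr0 infB -ge_min.
by rewrite max_r ?subr_ge0 ?(ltW Binf) // addrC subrK lexx orbT.
Unshelve. all: by end_near. Qed.
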